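(* Let $G$ be a graph and let $t\geq 0$ be an integer. Let $H$ be the $t$-core of $G$. Suppose that every edge of $H$ has multiplicity at most $t+1$ in $H$, and that the edges of $H$ of multiplicity exactly $t+1$ induce a multiforest. Then $\chi'(G)\leq \Delta(G)+t$.
   Context: A graph may have parallel edges but no loops. For vertices $x,y$, $\mu(x,y)$ is the number of edges joining $x$ and $y$ (the multiplicity of the edge $xy$); $\mu(v)=\max_{u}\mu(v,u)$ is the maximum multiplicity of an edge incident to $v$; $d(v)$ is the degree of $v$ (counting parallel edges); $\Delta(G)$ is the maximum degree. The $t$-core of $G$ is the subgraph of $G$ induced by the vertices $v$ with $d(v)+\mu(v)>\Delta(G)+t$. A multiforest is a graph whose underlying simple graph is a forest. $\chi'(G)$ is the chromatic index of $G$ (minimum number of colours in a proper edge-colouring). *)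

(* Defs.v *)
From mathcomp Require Import all_boot.

Set Implicit Arguments.
Unset Strict Implicit.
Unset Printing Implicit Defensive.

(* Finite multigraphs: parallel edges are distinct edges with the same set of
   ends, and the cardinality condition excludes loops. *)
Record mgraph := MGraph {
  vertex : finType;
  edge : finType;
  ends : edge -> {set vertex};
  card_ends : forall e, #|ends e| = 2
}.

Section Invariants.
Variable G : mgraph.

(* [multiplicity x x = 0], since an edge has two distinct ends. *)
Definition multiplicity (x y : vertex G) : nat :=
  #|[set e : edge G | ends e == [set x; y]]|.

Definition edge_multiplicity (e : edge G) : nat :=
  #|[set f : edge G | ends f == ends e]|.

Lemma edge_multiplicityE (e : edge G) (x y : vertex G) :
  ends e = [set x; y] -> edge_multiplicity e = multiplicity x y.
Proof. by rewrite /edge_multiplicity => ->. Qed.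

Definition max_multiplicity (v : vertex G) : nat :=
  \max_(u : vertex G) multiplicity v u.

Definition degree (v : vertex G) : nat :=
  #|[set e : edge G | v \in ends e]|.

Definition max_degree : nat := \max_(v : vertex G) degree v.

Definition proper_coloring k (c : {ffun edge G -> 'I_k}) : bool :=
  [forall e, forall f,
     (e != f) && (ends e :&: ends f != set0) ==> (c e != c f)].

Definition edge_colorable (k : nat) : bool :=
  [exists c : {ffun edge G -> 'I_k}, proper_coloring c].

Lemma edge_colorable_ex : exists k, edge_colorable k.
Proof.
exists #|edge G|; apply/existsP; exists [ffun e => enum_rank e].
apply/forallP => e; apply/forallP => f; apply/implyP => /andP [nef _].
by rewrite !ffunE (inj_eq enum_rank_inj).
Qed.

Definition chromatic_index : nat := ex_minn edge_colorable_ex.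

Definition adjacent : rel (vertex G) := fun x y => 0 < multiplicity x y.

(* Cycles of the underlying simple graph have length at least 3: a sequence of
   two adjacent vertices, even joined by parallel edges, is not one. *)
Definition multiforest : Prop :=
  forall c : seq (vertex G), 2 < size c -> ~ ucycle adjacent c.

End Invariants.

Section Subgraphs.
Variable G : mgraph.
Implicit Types (S : {set vertex G}) (F : {set edge G}).

Definition sub_vertex S : finType := {v : vertex G | v \in S}.
Definition sub_edge S F : finType :=
  {e : edge G | (e \in F) && (ends e \subset S)}.
Definition sub_ends S F (e : sub_edge S F) : {set sub_vertex S} :=
  [set v : sub_vertex S | val v \in ends (val e)].

Lemma card_sub_ends S F (e : sub_edge S F) : #|sub_ends e| = 2.
Proof.
rewrite -(card_ends (val e)) -(card_imset _ val_inj); congr #|pred_of_set _|.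
apply/setP => v; apply/imsetP/idP => [[u] + ->|ve]; first by rewrite inE.
have /andP [_ /subsetP sub] := valP e.
by exists (exist _ v (sub v ve)); rewrite ?inE.
Qed.

Definition subgraph S F : mgraph := MGraph (@card_sub_ends S F).

Definition induced_subgraph S : mgraph := subgraph S [set: edge G].

Definition edge_induced_subgraph F : mgraph :=
  subgraph (\bigcup_(e in F) ends e) F.

Definition core (t : nat) : mgraph :=
  induced_subgraph
    [set v : vertex G | degree v + max_multiplicity v > max_degree G + t].

End Subgraphs.

(* Main.v *)
Require Import Defs.
From mathcomp Require Import all_boot.
From mathcomp Require Import perm.

Set Implicit Arguments.
Unset Strict Implicit.
Unset Printing Implicit Defensive.

(** With [k = max_degree G + t], take a minimal set [F] of edges that is not
    [k]-colourable, colour all of [F] but one edge [e] at a vertex [x], and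
    consider the Vizing fan of [e] at [x].  The sets of colours missing at [x]
    and at the distinct ends [y] of the fan edges are pairwise disjoint, and a
    count of the fan edges gives
    [sum_y (mu_F(x,y) + d_F(y) - k) >= 2].
    A vertex [y] with a positive term lies in the core and is joined to [x] by
    at least [t+1] edges.  If [x] is in the core too, the bound [t+1] on
    multiplicities makes each term at most [1], so [x] has two such neighbours.
    Hence the edges of multiplicity [t+1] contain a nonempty subgraph whose
    underlying simple graph has minimum degree at least [2], so they contain a
    cycle. *)

(** * Paths, orbits of two involutions, and cycles in finite relations *)

Lemma sub_pairs_path (T : eqType) (r r' : rel T) x s :
    (forall y z, y \in belast x s -> z \in s -> r y z -> r' y z) ->
  path r x s -> path r' x s.
Proof.
elim: s x => //= z s IHs x sub_rr' /andP [rxz rzs].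
rewrite sub_rr' ?mem_head //=; apply: IHs => // u w us ws.
by apply: sub_rr'; rewrite inE (us, ws) orbT.
Qed.

Section InvolutionPair.
Variables (T : finType) (a b : T -> T) (x : T).
Hypotheses (aK : involutive a) (bK : involutive b) (ax : a x = x).

Let f := a \o b.
Let g := b \o a.

Let fK : cancel f g.
Proof. by move=> y; rewrite /f /g /= aK bK. Qed.

Let gK : cancel g f.
Proof. by move=> y; rewrite /f /g /= bK aK. Qed.

Let iter_gK n : cancel (iter n g) (iter n f).
Proof. by elim: n => // n IHn y; rewrite [LHS]iterSr [iter n.+1 g y]iterS gK IHn. Qed.

Let a_iter n : a (iter n f x) = iter n g x.
Proof. by elim: n => //= n IHn; rewrite -IHn /f /g /= !aK. Qed.

(** The involution [a] fixes [x] and conjugates [a \o b] to its inverse, so it reverses the orbit of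
    [x]. *)
Lemma fconnect_involl y : fconnect (a \o b) x y -> fconnect (a \o b) x (a y).
Proof.
move=> /iter_findex <-; rewrite a_iter.
rewrite fconnect_sym; last exact: can_inj fK.
rewrite -[X in fconnect _ _ X](iter_gK (findex (a \o b) x y) x).
exact: fconnect_iter.
Qed.

Lemma fconnect_involr y : fconnect (a \o b) x y -> fconnect (a \o b) x (b y).
Proof.
move=> xy; rewrite -[b y]aK; apply: fconnect_involl.
exact: connect_trans xy (fconnect1 (a \o b) y).
Qed.

(* In the dihedral orbit of a fixed point of [a], a point [f^i x] is fixed by
   [b] exactly when [f^(2i+1) x = x]; two such relations force [f^(j-i) x = x]
   because [2i+1] is odd. *)
Lemma fixed_involr_unique y z :
    fconnect (a \o b) x y -> fconnect (a \o b) x z -> b y = y -> b z = z ->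
  y = z.
Proof.
have fixedE n : b (iter n f x) = iter n f x -> iter n.*2.+1 f x = x.
  move=> bE; have : iter n f x = iter n.+1 g x by rewrite iterS -a_iter /g /= aK.
  by move/(congr1 (iter n.+1 f)); rewrite iter_gK -iterD addSn addnn.
move=> /iter_findex <- /iter_findex <-.
rewrite -/f; move: (findex f x y) (findex f x z) => i j {y z}.
wlog le_ij : i j / i <= j => [th bi bj|].
  by case: (leqP i j) => [/th|/ltnW le_ji]; [apply | apply/esym/th].
move=> /fixedE fi /fixedE fj; move: le_ij fj => /subnK <-.
move: (j - i) => {j} d; rewrite doubleD -addnS iterD fi => f2d.
have iterM n m : iter n f x = x -> iter (m * n) f x = x.
  by move=> fn; elim: m => // m IHm; rewrite mulSn iterD IHm.
(* Both [d.*2] and [i.*2.+1] are periods at [x], and [d * i.*2.+1 = d + i * d.*2]. *)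
have fd : iter d f x = x.
  rewrite -{1}(iterM _ i f2d) -iterD -[RHS](iterM _ d fi); congr iter.
  by rewrite mulnS -!muln2 mulnCA mulnA.
by rewrite addnC iterD fd.
Qed.

End InvolutionPair.

Section MinDegreeTwo.
Variables (T : finType) (r : rel T) (S : {set T}) (x0 : T).
Hypotheses (r_sym : symmetric r) (r_irr : irreflexive r) (Sx0 : x0 \in S).
Hypothesis deg2 :
  forall x u, x \in S -> exists y, [/\ y \in S, y != u & r x y].

(* The head of a longest path in [S] has a second neighbour, which closes a
   cycle. *)
Lemma cycle_of_min_degree2 : exists c, 2 < size c /\ ucycle r c.
Proof.
suff ext n x p : #|T| - size p <= n -> x \in S -> path r x p -> uniq (x :: p) ->
    exists c, 2 < size c /\ ucycle r c.
  exact: (@ext #|T| x0 [::]) (leq_subr _ _) Sx0 isT isT.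
elim: n x p => [|n IHn] x p le_n Sx rxp Up.
  by have := max_card (mem (x :: p)); rewrite (card_uniqP Up) /= ltnNge -subn_eq0 -leqn0 le_n.
(* Avoiding the successor of [x] on the path forces the cycle closed at [y] to have at least 3
   vertices. *)
have [y [Sy y_head rxy]] := deg2 (head x p) Sx.
have y_x : y != x by apply: contraTneq rxy => ->; rewrite r_irr.
case yp: (y \in p); last first.
  apply: (IHn y (x :: p)) => //=; last by rewrite inE negb_or y_x yp.
    by rewrite subnS; case: (_ - _) le_n.
  by rewrite r_sym rxy.
case/path.splitP: yp rxp Up y_head => p1 p2.
rewrite cat_path => /andP [rxp1 _] Up y_head.
exists (x :: rcons p1 y); split.
  by case: p1 y_head {rxp1 Up} => [|? ?]; rewrite /= ?eqxx // size_rcons.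
rewrite /ucycle /= rcons_path rxp1 last_rcons r_sym rxy /=.
by move: Up; rewrite /= mem_cat cat_uniq negb_or => /andP [/andP [-> _] /andP [-> _]].
Qed.

End MinDegreeTwo.

(** * Edge ends and partial edge-colourings *)

Section EdgeEnds.
Variable G : mgraph.
Implicit Types (e f : edge G) (u v : vertex G).

Definition other e v : vertex G := odflt v [pick u in ends e :\ v].

Lemma ends_other e v : v \in ends e -> ends e = [set v; other e v].
Proof.
move=> ve; rewrite -(setD1K ve) /other.
have /cards1P [w ->] : #|ends e :\ v| == 1.
  by have := cardsD1 v (ends e); rewrite card_ends ve add1n => -[<-].
by case: pickP => [u|/(_ w)]; rewrite inE ?eqxx // => /eqP ->.
Qed.

Lemma other_neq e v : v \in ends e -> other e v != v.
Proof.
move=> /ends_other eE; apply: contra_eqN (card_ends e) => /eqP ov.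
by rewrite eE ov setUid cards1.
Qed.

Lemma other_ends e v : v \in ends e -> other e v \in ends e.
Proof. by move=> /ends_other ->; rewrite !inE eqxx orbT. Qed.

Lemma eq_other e u v : u \in ends e -> v \in ends e -> u != v -> u = other e v.
Proof.
by move=> ue ve; rewrite (ends_other ve) !inE in ue; case/orP: ue => /eqP -> //; rewrite eqxx.
Qed.

Lemma otherK e v : v \in ends e -> other e (other e v) = v.
Proof.
move=> ve; apply/esym/eq_other; rewrite ?other_ends //.
by rewrite eq_sym other_neq.
Qed.

End EdgeEnds.

Section PartialColorings.
Variables (G : mgraph) (k : nat).
Implicit Types (e f g : edge G) (u v x y : vertex G) (a b : 'I_k).
Implicit Types (F : {set edge G}).

Definition pcoloring := {ffun edge G -> option 'I_k}.
Implicit Types c : pcoloring.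

Definition partial_proper c : bool :=
  [forall e, forall f, forall v, forall a,
     [&& v \in ends e, v \in ends f, c e == Some a & c f == Some a]
     ==> (e == f)].

Lemma partial_properP c :
  reflect (forall e f v a, v \in ends e -> v \in ends f ->
             c e = Some a -> c f = Some a -> e = f) (partial_proper c).
Proof.
apply: (iffP forallP) => [Pc e f v a ve vf ce cf | Pc e].
  have /forallP/(_ f)/forallP/(_ v)/forallP/(_ a) := Pc e.
  by rewrite ve vf ce cf !eqxx => /eqP.
apply/forallP => f; apply/forallP => v; apply/forallP => a; apply/implyP.
by case/and4P => ve vf /eqP ce /eqP cf; apply/eqP/(Pc _ _ v a).
Qed.

Definition dom c := [set e | c e != None].

Definition colorable F := [exists c : pcoloring, partial_proper c && (dom c == F)].

Definition missing c v a := [forall e, (v \in ends e) ==> (c e != Some a)].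

Lemma missingP c v a :
  reflect (forall e, v \in ends e -> c e <> Some a) (missing c v a).
Proof.
apply: (iffP forallP) => H e; first by have := H e => /implyP He /He /eqP.
by apply/implyP => ve; apply/eqP/H.
Qed.

Lemma not_missing c v a :
  ~~ missing c v a -> exists2 e, v \in ends e & c e = Some a.
Proof.
by case/forallPn => e; rewrite negb_imply negbK => /andP [ve /eqP ce]; exists e.
Qed.

Definition update c e o : pcoloring := [ffun f => if f == e then o else c f].

Lemma proper_erase c e : partial_proper c -> partial_proper (update c e None).
Proof.
move=> /partial_properP Pc; apply/partial_properP => f g v a vf vg; rewrite !ffunE.
by case: ifP; case: ifP => // _ _; apply: Pc vf vg.
Qed.

Lemma proper_update c e a :
  partial_proper c -> {in ends e, forall v, missing c v a} -> partial_proper (update c e (Some a)).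
Proof.
move=> /partial_properP Pc mis; apply/partial_properP => f g v b vf vg; rewrite !ffunE.
case: eqP => [fe|_]; case: eqP => [ge|_]; rewrite ?fe ?ge //.
- by move=> [<-] cg; rewrite fe in vf; have /missingP/(_ g vg) := mis v vf.
- by move=> cf [ab]; rewrite ge in vg; have /missingP/(_ f vf) := mis v vg; rewrite ab.
- exact: Pc vf vg.
Qed.

Lemma dom_update c e a : dom (update c e (Some a)) = e |: dom c.
Proof. by apply/setP => f; rewrite !inE ffunE; case: (f == e). Qed.

Lemma dom_erase c e : dom (update c e None) = dom c :\ e.
Proof. by apply/setP => f; rewrite !inE ffunE; case: (f == e). Qed.

Definition sub_degree F v := #|[set e in F | v \in ends e]|.

Definition sub_multiplicity F x y := #|[set e in F | ends e == [set x; y]]|.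

(** A proper colouring is injective on the coloured edges at [v], so these edges match the colours
    present there. *)
Lemma card_missing c v :
  partial_proper c -> #|[set a | missing c v a]| + sub_degree (dom c) v = k.
Proof.
move=> /partial_properP Pc; rewrite -[RHS]card_ord -(cardsC [set a | missing c v a]).
congr addn; rewrite /sub_degree -(card_imset (~: _) Some_inj).
rewrite -(@card_in_imset _ _ c) => [|e f]; last first.
  rewrite !inE => /andP [ce ve] /andP [_ vf] cef.
  by case Ece: (c e) ce => [a|//] _; apply: (Pc e f v a); rewrite -?cef.
apply: eq_card => o; apply/imsetP/imsetP => [[e]|[a]].
  rewrite !inE => /andP [ce ve] ->; case Ece: (c e) ce => [a|//] _.
  by exists a => //; rewrite !inE; apply/missingP => /(_ e ve).
rewrite !inE => /not_missing [e ve ce] ->.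
by exists e; rewrite ?inE ?ce ?ve.
Qed.

(** Kempe chains are encoded by involutions: the fixed points of [mate c a] are the vertices missing
    [a], and the chain in colours [a], [b] starting at such a vertex is its orbit under
    [mate c a \o mate c b]. *)
Definition mate c a v :=
  if [pick e | (v \in ends e) && (c e == Some a)] is Some e then other e v else v.

Lemma mate_edge c a e v :
  partial_proper c -> v \in ends e -> c e = Some a -> mate c a v = other e v.
Proof.
move=> /partial_properP Pc ve ce; rewrite /mate; case: pickP => [f|/(_ e)].
  by case/andP => vf /eqP cf; rewrite (Pc f e v a).
by rewrite ve ce eqxx.
Qed.

Lemma mate_missing c a v : missing c v a -> mate c a v = v.
Proof.
move=> /missingP mis; rewrite /mate; case: pickP => // e /andP [ve /eqP].
by move/mis: ve.
Qed.

Lemma mateK c a : partial_proper c -> involutive (mate c a).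
Proof.
move=> Pc v; case: (boolP (missing c v a)) => [/[dup] m /mate_missing -> |].
  exact: mate_missing.
case/not_missing => e ve ce; rewrite (mate_edge Pc ve ce).
by rewrite (mate_edge Pc (other_ends ve) ce) otherK.
Qed.

End PartialColorings.

(** * Vizing fans and Kempe chains *)

Section Fans.
Variables (G : mgraph) (k : nat) (F : {set edge G}) (x : vertex G).
Implicit Types (e f g : edge G) (u v y : vertex G) (a b : 'I_k).
Implicit Types (c : pcoloring G k).

(** The edges reachable from an uncoloured edge at [x] form its maximal multi-fan; no linear order
    on the fan is fixed. *)
Definition fan_step c : rel (edge G) := fun f g =>
  (x \in ends g) && [exists a, (c g == Some a) && missing c (other f x) a].

Lemma fan_stepP c f g :
  reflect (x \in ends g /\ exists2 a, c g = Some a & missing c (other f x) a)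
          (fan_step c f g).
Proof.
apply: (iffP andP) => -[xg].
  by case/existsP => a /andP [/eqP ca m]; split => //; exists a.
by case=> a ca m; split=> //; apply/existsP; exists a; rewrite ca eqxx.
Qed.

(* Shift the colours along the path towards its uncoloured first edge. *)
Lemma fan_shift c e p a :
    partial_proper c -> dom c = F :\ e -> e \in F -> x \in ends e ->
    path (fan_step c) e p -> uniq (e :: p) ->
    missing c x a -> missing c (other (last e p) x) a ->
  colorable k F.
Proof.
elim: p c e => [|f p IHp] c e Pc dc eF xe.
  move=> _ _ mx mo; apply/existsP; exists (update c e (Some a)).
  rewrite dom_update dc setD1K // eqxx andbT; apply: proper_update => // v.
  by rewrite (ends_other xe) !inE => /orP [] /eqP ->.
move=> /andP [/fan_stepP [xf [b cf mob]] pth] /= /andP [e_fp /andP [f_p Up]] mx mo.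
have fF : f \in F :\ e by rewrite -dc inE cf.
have f_e : f != e by case/setD1P: fF.
have ce : c e = None by apply/eqP; have := setD11 e F; rewrite -dc inE => /negbFE.
pose c1 := update (update c f None) e (Some b).
have c1E g : c1 g = if g == e then Some b else if g == f then None else c g.
  by rewrite !ffunE.
(* The shift introduces no new colour but [b] at any vertex. *)
have mis1 v d : d != b -> missing c v d -> missing c1 v d.
  move=> db /missingP m; apply/missingP => g vg; rewrite c1E.
  by do 2?case: ifP => // _; [case=> bd; rewrite bd eqxx in db | apply: m].
have Pc1 : partial_proper c1.
  apply: proper_update => [|v]; first exact: proper_erase.
  rewrite (ends_other xe) !inE => vE; apply/missingP => g vg; rewrite ffunE.
  case: eqP => // gf cg; case/orP: vE => /eqP Ev.
    by apply: gf; apply: (partial_properP _ Pc g f x b) => //; rewrite -Ev.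
  by move/missingP: mob => /(_ g); rewrite -Ev => /(_ vg).
(* Since [f] carries [b] at [x], the later fan edges have other colours, so their fan steps survive
   the shift. *)
have x_color g d : x \in ends g -> g != f -> c g = Some d -> d != b.
  move=> xg gf cg; apply: contraNneq gf => db; apply/eqP.
  by apply: (partial_properP _ Pc g f x b) => //; rewrite cg db.
have a_b : a != b.
  by apply: contraTneq mx => ->; apply/missingP => /(_ f xf).
apply: (IHp c1 f) => //.
- rewrite dom_update dom_erase dc; apply/setP => g; rewrite !inE.
  by case: eqP => [->|//]; rewrite eF eq_sym f_e.
- by case/setD1P: fF.
- apply: sub_pairs_path pth => g h _ hp /fan_stepP [xh [d ch m]].
  have hf : h != f by apply: contraNneq f_p => <-.
  have he : h != e by apply: contraNneq e_fp => <-; rewrite inE hp orbT.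
  apply/fan_stepP; split=> //; exists d; first by rewrite c1E (negbTE hf) (negbTE he).
  exact/mis1/m/(x_color h).
- by rewrite /= f_p.
- exact: mis1.
- exact: mis1.
Qed.

Section Elementary.
Variables (c : pcoloring G k) (e : edge G) (a : 'I_k).
Hypotheses (Pc : partial_proper c) (dc : dom c = F :\ e) (eF : e \in F).
Hypotheses (xe : x \in ends e) (mxa : missing c x a).
Hypothesis not_colorable : ~~ colorable k F.

(** Otherwise shifting along a repetition-free path to [g] frees [g] to receive [b], which colours
    all of [F]. *)
Lemma fan_not_missing g b :
  connect (fan_step c) e g -> missing c x b -> ~~ missing c (other g x) b.
Proof.
move=> /connectP [p /shortenP [q pth Uq _ ->]] mx; apply: contra not_colorable.
exact: fan_shift.
Qed.

(* Otherwise swap [a] and [b] outside the component of [x]: the fan survives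
   up to its first vertex outside that component which missed [b], and this
   vertex now misses [a], as [x] does. *)
Lemma fan_kempe g b :
    connect (fan_step c) e g -> missing c (other g x) b ->
  fconnect (mate c a \o mate c b) x (other g x).
Proof.
move=> /connectP [p /shortenP [q pth Uq _ ->]] {g p} mb.
apply: contraR not_colorable => out.
pose C := [set v | fconnect (mate c a \o mate c b) x v].
have Cclosed h v d : v \in C -> v \in ends h -> c h = Some d -> (d == a) || (d == b) ->
    other h v \in C.
  rewrite !inE => vC vh ch /orP [] /eqP dE.
    rewrite -(mate_edge Pc vh (etrans ch (congr1 _ dE))).
    by apply: fconnect_involl vC; rewrite ?mate_missing //; apply: mateK.
  rewrite -(mate_edge Pc vh (etrans ch (congr1 _ dE))).
  by apply: fconnect_involr vC; rewrite ?mate_missing //; apply: mateK.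
pose c1 : pcoloring G k := [ffun h =>
  if [exists v in ends h, v \in C] then c h else omap (tperm a b) (c h)].
(* An edge with just one end in [C] has neither colour [a] nor [b], so the swap fixes it and either
   end determines its new colour. *)
have c1E h v : v \in ends h -> c1 h = if v \in C then c h else omap (tperm a b) (c h).
  move=> vh; rewrite ffunE; case: ifP => [/exists_inP [u uh uC]|/negbT no].
    case: ifP => // vC; case ch: (c h) => [d|//] /=; rewrite permE /=.
    have uv : v != u by apply: contraFneq vC => ->.
    have := Cclosed h u d uC uh ch; rewrite -(eq_other vh uh uv) vC.
    by do 2?case: eqP => //= _; move/(_ isT).
  by case: ifP => // vC; case/exists_inP: no; exists v.
have mis1 v d : missing c1 v d = missing c v (if v \in C then d else tperm a b d).
  apply/missingP/missingP => m h vh; have := m h vh; rewrite (c1E h v vh);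
    case: (v \in C) => //; case: (c h) => [d'|//] /= dn []; last first.
    by move=> dE; apply: dn; rewrite -dE tpermK.
  by move=> dE; apply: dn; rewrite dE tpermK.
have Pc1 : partial_proper c1.
  apply/partial_properP => h h' v d vh vh'; rewrite !(c1E _ v) //.
  case: ifP => _; first exact: (partial_properP _ Pc h h' v d vh vh').
  case ch: (c h) => [d1|//] [<-]; case ch': (c h') => [d2|//] [/perm_inj d12].
  by apply: (partial_properP _ Pc h h' v d1); rewrite // ch' d12.
have dc1 : dom c1 = F :\ e.
  by rewrite -dc; apply/setP => h; rewrite !inE ffunE; case: ifP; case: (c h).
have xC : x \in C by rewrite inE connect0.
pose bad h := (other h x \notin C) && missing c (other h x) b.
have bad_color h : bad h -> missing c1 (other h x) a.
  by case/andP => hC m; rewrite mis1 (negbTE hC) tpermL.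
have mxa1 : missing c1 x a by rewrite mis1 xC.
have: has bad (e :: q).
  by apply/hasP; exists (last e q); [exact: mem_last | rewrite /bad inE out].
rewrite /=; case: (boolP (bad e)) => [be _|be /=].
  exact: (fan_shift (p := [::]) Pc1 dc1 eF xe _ _ mxa1 (bad_color _ be)).
move=> hq; case/split_find: hq pth Uq => z q1 q2 bz nb.
rewrite cat_path => /andP [pth _]; rewrite -cat_cons cat_uniq => /andP [Uq _].
apply: (fan_shift Pc1 dc1 eF xe _ Uq mxa1); last first.
  by rewrite last_rcons; apply: bad_color.
apply: sub_pairs_path pth => g h; rewrite belast_rcons => gq _.
have bg : ~~ bad g.
  move: gq; rewrite inE => /orP [/eqP -> //|gq]; apply: contra nb => bg.
  by apply/hasP; exists g.
case/fan_stepP => xh [d ch m]; apply/fan_stepP; split => //.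
exists d; first by rewrite (c1E h x) // xC.
(* Outside [C], the colour [d] is not [a], because [h] carries it at [x], and not [b], because [g]
   is not bad; the swap fixes it. *)
rewrite mis1; case: ifP => gC //; case: tpermP m => // dE m.
  by move/missingP: mxa => /(_ h xh); rewrite ch dE.
by rewrite /bad gC -dE m in bg.
Qed.

(** Both far ends lie on the Kempe chain starting at [x], and both are ends of it because they miss
    [b]; the chain has only one such end. *)
Lemma fan_missing_unique g h b :
    connect (fan_step c) e g -> connect (fan_step c) e h ->
    missing c (other g x) b -> missing c (other h x) b ->
  other g x = other h x.
Proof.
move=> eg eh mg mh.
apply: (@fixed_involr_unique _ (mate c a) (mate c b) x); rewrite ?mate_missing //.
- exact: mateK.
- exact: mateK.
- exact: fan_kempe.
- exact: fan_kempe.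
Qed.


Lemma fan_mem g : connect (fan_step c) e g -> (g \in F) && (x \in ends g).
Proof.
case/connectP => p; case/lastP: p => [_ -> /=|p f]; first by rewrite eF.
rewrite rcons_path last_rcons => /andP [_ /fan_stepP [xf [d cf _]]] ->.
have : f \in F :\ e by rewrite -dc inE cf.
by rewrite xf andbT => /setD1P [].
Qed.

(** Each colour missing at a far end is present at [x], on a fan edge of its own other than [e], so
    the far ends miss fewer colours than the fan has edges. This strictness gives one unit of the
    [2]; the other is the extra colour missing at the far end of the uncoloured [e]. *)
Lemma fan_count : exists Y : {set vertex G},
  k * #|Y| + 2 <= \sum_(y in Y) (sub_multiplicity F x y + sub_degree F y).
Proof.
pose M := [set g | connect (fan_step c) e g].
pose Y := [set other g x | g in M].
have eM : e \in M by rewrite inE connect0.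
have leM : #|M| <= \sum_(y in Y) sub_multiplicity F x y.
  rewrite -sum1_card (partition_big_imset (fun g => other g x)) /=.
  apply: leq_sum => y _; rewrite sum1dep_card; apply/subset_leq_card/subsetP => g.
  rewrite !inE => /andP [/fan_mem /andP [-> xg] /eqP <-].
  by rewrite -(ends_other xg) eqxx.
have geM : \sum_(y in Y) #|[set a | missing c y a]| < #|M|.
  rewrite (cardsD1 e) eM add1n ltnS.
  under eq_bigr => y _ do rewrite -sum1_card.
  rewrite pair_big_dep /= sum1dep_card.
  set W := [set _ | _].
  (* A missing colour determines its far end; [Some] allows comparison with the image of the fan
     edges under [c]. *)
  have inj : {in W &, injective (fun p : vertex G * 'I_k => Some p.2)}.
    move=> [y b] [y' b']; rewrite !inE /=.
    case/andP => /imsetP [g gM ->] m /andP [/imsetP [h hM ->] m'] [bb].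
    rewrite inE in gM; rewrite inE in hM.
    by rewrite -bb in m' *; rewrite (fan_missing_unique gM hM m m').
  rewrite -(card_in_imset inj); apply: leq_trans (leq_imset_card c _).
  apply/subset_leq_card/subsetP => o /imsetP [[y b]].
  rewrite !inE /= => /andP [/imsetP [g]]; rewrite inE => gM -> m ->.
  have /not_missing [h xh ch] : ~~ missing c x b.
    by apply: contraL m; apply: fan_not_missing.
  apply/imsetP; exists h => //; rewrite !inE; apply/andP; split.
    apply: contra_eqN ch => /eqP ->.
    by have := setD11 e F; rewrite -dc inE => /negbFE /eqP ->.
  by apply: connect_trans gM (connect1 _); apply/fan_stepP; split => //; exists b.
exists Y; rewrite big_split /=.
(* The edge [e] counts in [F] but is uncoloured, hence the correction at its ends. *)
have degE y : k + (y \in ends e) = #|[set a | missing c y a]| + sub_degree F y.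
  rewrite -{1}(card_missing y Pc) dc -addnA; congr addn.
  rewrite /sub_degree (cardsD1 e [set f in F | _]) inE eF addnC /=; congr addn.
  by apply: eq_card => f; rewrite !inE andbA.
have : k * #|Y| + 1 <= \sum_(y in Y) (k + (y \in ends e)).
  rewrite big_split /= sum_nat_const mulnC leq_add2l (bigD1 (other e x)) /=.
    by rewrite other_ends.
  by apply/imsetP; exists e.
rewrite (eq_bigr _ (fun y _ => degE y)) big_split /= => le_sum.
rewrite addnS; apply: leq_ltn_trans le_sum _.
by rewrite ltn_add2r; apply: leq_trans geM leM.
Qed.

End Elementary.
End Fans.

(** * Critical edge sets and multiplicities in subgraphs *)

Lemma sub_degree_le (G : mgraph) (F : {set edge G}) v : sub_degree F v <= degree v.
Proof. by apply/subset_leq_card/subsetP => e; rewrite !inE => /andP []. Qed.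

Lemma sub_multiplicity_le (G : mgraph) (F : {set edge G}) x y :
  sub_multiplicity F x y <= multiplicity x y.
Proof. by apply/subset_leq_card/subsetP => e; rewrite !inE => /andP []. Qed.

Lemma degree_le_max (G : mgraph) (v : vertex G) : degree v <= max_degree G.
Proof. exact: (leq_bigmax (F := @degree G)). Qed.

Lemma multiplicity_le_max (G : mgraph) (v u : vertex G) :
  multiplicity v u <= max_multiplicity v.
Proof. exact: (leq_bigmax (F := multiplicity v)). Qed.

Lemma multiplicityC (G : mgraph) (x y : vertex G) : multiplicity x y = multiplicity y x.
Proof. by rewrite /multiplicity setUC. Qed.

Lemma multiplicityxx (G : mgraph) (x : vertex G) : multiplicity x x = 0.
Proof.
apply/eqP; rewrite cards_eq0; apply/eqP/setP => e; rewrite !inE setUid.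
by apply: contra_eqF (card_ends e) => /eqP ->; rewrite cards1.
Qed.

(** The excesses over [k] in [fan_count] add up to at least 2, so either a vertex other than [u] has
    positive excess or [u] alone has excess at least 2. Here [u] is a neighbour to be avoided. *)
Lemma critical_fan (G : mgraph) k (F : {set edge G}) e x u :
    max_degree G <= k -> ~~ colorable k F -> colorable k (F :\ e) ->
    e \in F -> x \in ends e ->
  (exists2 y, y != u & k < sub_multiplicity F x y + sub_degree F y) \/
  k.+1 < sub_multiplicity F x u + sub_degree F u.
Proof.
move=> le_k nF /existsP [c /andP [Pc /eqP dc]] eF xe.
(* The uncoloured [e] leaves fewer than [max_degree G] coloured edges at [x]. *)
have [a mxa] : exists a, missing c x a.
  suff: 0 < #|[set a | missing c x a]| by case/card_gt0P => a; rewrite inE; exists a.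
  rewrite -(ltn_add2r (sub_degree (dom c) x)) add0n card_missing // dc.
  apply: leq_trans (leq_trans (degree_le_max x) le_k).
  apply: leq_trans (sub_degree_le F x); apply: proper_card.
  apply/properP; split; last by exists e; rewrite !inE ?eF ?xe ?eqxx.
  by apply/subsetP => f; rewrite !inE -andbA => /and3P [_ -> ->].
have [Y leY] := fan_count Pc dc eF xe mxa nF.
have [/ltnW|] := ltnP k.+1 (sub_multiplicity F x u + sub_degree F u); first by right.
move=> le_u; left.
suff /exists_inP [y] : [exists y in predC1 u, k < sub_multiplicity F x y + sub_degree F y].
  by exists y.
apply: contraLR leY => /exists_inPn small; rewrite -ltnNge.
apply: (@leq_ltn_trans (\sum_(y in Y) (k + (y == u)))).
  apply: leq_sum => y _; case: eqP => [->|/eqP yu]; first by rewrite addn1.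
  by rewrite addn0 leqNgt small.
rewrite big_split /= sum_nat_const mulnC ltn_add2l ltnS.
case: (boolP (u \in Y)) => uY; last first.
  by rewrite big1 // => y yY; case: eqP yY uY => // -> ->.
by rewrite (bigD1 u) //= eqxx big1 // => y /andP [_ /negbTE ->].
Qed.

Lemma edge_colorable_setT (G : mgraph) k :
  colorable k [set: edge G] -> edge_colorable G k.
Proof.
case/existsP => c /andP [/partial_properP Pc /eqP dc].
have /fin_all_exists [f cE] e : exists a, c e = Some a.
  by have := in_setT e; rewrite -dc inE; case: (c e) => // a; exists a.
apply/existsP; exists [ffun e => f e]; apply/forallP => e; apply/forallP => g.
apply/implyP => /andP [ne /set0Pn [v /setIP [ve vg]]]; rewrite !ffunE.
by apply: contraNneq ne => fe; apply/eqP/(Pc e g v (f e)); rewrite ?cE ?fe.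
Qed.

Lemma colorable_set0 (G : mgraph) k : colorable k (set0 : {set edge G}).
Proof.
apply/existsP; exists [ffun=> None]; apply/andP; split.
  by apply/partial_properP => e f v a _ _; rewrite ffunE.
by apply/eqP/setP => e; rewrite !inE ffunE.
Qed.

Lemma imset_sub_ends (G : mgraph) (S : {set vertex G}) F (e : sub_edge S F) :
  val @: sub_ends e = ends (val e).
Proof.
apply/setP => v; apply/imsetP/idP => [[u] + ->|ve]; first by rewrite inE.
have /andP [_ /subsetP sub] := valP e.
by exists (exist _ v (sub v ve)); rewrite ?inE.
Qed.

Lemma multiplicity_subgraph (G : mgraph) (S : {set vertex G}) F (x y : sub_vertex S) :
  multiplicity (G := subgraph S F) x y = sub_multiplicity F (val x) (val y).
Proof.
rewrite /multiplicity -(card_imset _ val_inj) /sub_multiplicity.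
have val2 : val @: [set x; y] = [set val x; val y] by rewrite imsetU1 imset_set1.
apply: eq_card => e; apply/imsetP/idP => [[f] + ->|].
  rewrite !inE => /eqP fE; have /andP [-> _] := valP f.
  by rewrite -imset_sub_ends -val2 -fE /=.
rewrite inE => /andP [eF /eqP eE].
have eS : (e \in F) && (ends e \subset S).
  by rewrite eF eE; apply/subsetP => v; rewrite !inE => /orP [] /eqP ->; apply: valP.
exists (exist _ e eS) => //; rewrite inE; apply/eqP/(imset_inj val_inj).
by rewrite imset_sub_ends val2.
Qed.

Lemma multiplicity_edge (G : mgraph) (x y : vertex G) :
  0 < multiplicity x y -> exists e : edge G, ends e = [set x; y].
Proof. by case/card_gt0P => e; rewrite inE => /eqP; exists e. Qed.

Lemma multiplicity_core (G : mgraph) t (x y : vertex (core G t)) :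
  multiplicity x y = multiplicity (val x) (val y).
Proof.
by rewrite (multiplicity_subgraph [set: edge G]); apply: eq_card => e; rewrite !inE.
Qed.

Lemma edge_induced_adjacent (G : mgraph) (F : {set edge G}) e x y :
    e \in F -> ends e = [set x; y] ->
  exists X Y : vertex (edge_induced_subgraph F),
    [/\ val X = x, val Y = y & adjacent X Y].
Proof.
move=> eF eE.
have inU v : v \in [set x; y] -> v \in \bigcup_(f in F) ends f.
  by rewrite -eE => ve; apply/bigcupP; exists e.
exists (exist _ x (inU x (set21 x y))), (exist _ y (inU y (set22 x y))).
split=> //; rewrite /adjacent multiplicity_subgraph; apply/card_gt0P.
by exists e; rewrite inE eF eE eqxx.
Qed.

(** * A cycle of edges of multiplicity [t.+1] in the core *)

Theorem theorem1p4 (G : mgraph) (t : nat)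
  (core_mult : forall e : edge (core G t), edge_multiplicity e <= t.+1)
  (core_forest :
     multiforest
       (edge_induced_subgraph
          [set e : edge (core G t) | edge_multiplicity e == t.+1])) :
  chromatic_index G <= max_degree G + t.
Proof.
set k := max_degree G + t.
suff colG : edge_colorable G k.
  by rewrite /chromatic_index; case: ex_minnP => m _; apply.
apply: edge_colorable_setT; apply: contraT => notG.
have [|F /minsetP [nF minF]] := @ex_minset _ (fun F : {set edge G} => ~~ colorable k F).
  by exists [set: edge G].
have crit e : e \in F -> colorable k (F :\ e).
  move=> eF; apply: contraT => /minF/(_ (subsetDl _ _))/setP/(_ e).
  by rewrite setD11 eF.
have core_multG (x y : vertex (core G t)) : multiplicity x y <= t.+1.
  case: (posnP (multiplicity x y)) => [-> //|/multiplicity_edge [e eE]].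
  by rewrite -(edge_multiplicityE eE).
(* The fan argument needs an edge of [F] at its centre, so the cycle is sought among the vertices
   that [F] covers. *)
pose supp v := [exists e in F, v \in ends e].
have heavy x y : k < sub_multiplicity F x y + sub_degree F y ->
    exists y' : vertex (core G t), [/\ val y' = y, supp y & t < multiplicity x y].
  move=> lt_k; have le_m := sub_multiplicity_le F x y.
  have lt_m : t < sub_multiplicity F x y.
    have le_d := leq_trans (sub_degree_le F y) (degree_le_max y).
    by rewrite -(ltn_add2r (max_degree G)) addnC; apply: leq_trans lt_k _; rewrite leq_add2l.
  have yC : y \in [set v | degree v + max_multiplicity v > max_degree G + t].
    rewrite inE -/k; apply: leq_trans lt_k _; rewrite addnC; apply: leq_add (sub_degree_le F y) _.
    by apply: leq_trans le_m _; rewrite multiplicityC multiplicity_le_max.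
  exists (exist _ y yC); split=> //; last exact: leq_trans lt_m le_m.
  have /card_gt0P [e] : 0 < sub_multiplicity F x y by case: (sub_multiplicity _ _ _) lt_m.
  rewrite inE => /andP [eF /eqP eE]; apply/exists_inP; exists e => //.
  by rewrite eE set22.
have fan_step (x : vertex (core G t)) u : supp (val x) ->
    exists y : vertex (core G t),
      [/\ supp (val y), val y != u & multiplicity x y = t.+1].
  case/exists_inP => e eF xe.
  have [] := critical_fan u (leq_addr t _) nF (crit e eF) eF xe.
    case=> y yu /heavy [y' [yE sy lt_m]]; exists y'; rewrite yE; split=> //.
    by apply/eqP; rewrite eqn_leq core_multG multiplicity_core yE.
  (* Excess at least 2 at [u] would force multiplicity at least [t.+2] between two core vertices. *)
  move=> lt_k; have [u' [uE _ _]] := heavy _ _ (ltnW lt_k).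
  have := core_multG x u'; rewrite multiplicity_core uE leqNgt => /negP [].
  rewrite -(ltn_add2r (max_degree G)) addSn addnC -/k; apply: leq_trans lt_k _.
  apply: leq_add (sub_multiplicity_le _ _ _) _.
  exact: leq_trans (sub_degree_le _ _) (degree_le_max _).
have [e0 e0F] : exists e, e \in F.
  by apply/set0Pn; apply: contraNneq nF => ->; apply: colorable_set0.
have [x0 x0e] : exists x, x \in ends e0.
  by apply/set0Pn; rewrite -card_gt0 card_ends.
have [x1 sx1] : exists x : vertex (core G t), supp (val x).
  (* The vertex [x0] may lie outside the core, but its fan reaches a core vertex; avoiding [x0]
     itself voids the second alternative, as there are no loops. *)
  have [] := critical_fan x0 (leq_addr t _) nF (crit e0 e0F) e0F x0e.
    by case=> y _ /heavy [y' [<- sy _]]; exists y'.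
  by move=> /ltnW /heavy [y' [_ _]]; rewrite multiplicityxx.
set D := [set e | _] in core_forest.
have lift x y : multiplicity x y = t.+1 ->
    exists X Y : vertex (edge_induced_subgraph D),
    [/\ val X = x, val Y = y & adjacent X Y].
  move=> xy; have [|e eE] := @multiplicity_edge _ x y; first by rewrite xy.
  by apply: (edge_induced_adjacent (e := e)); rewrite // inE (edge_multiplicityE eE) xy.
pose S := [set v : vertex (edge_induced_subgraph D) | supp (val (val v))].
(* An edge of multiplicity [t.+1] at [x1] is needed only to view [x1] as a vertex of the
   edge-induced subgraph. *)
have [x2 [_ _ /lift [X [_ [XE _ _]]]]] := fan_step x1 (val x1) sx1.
have [] := @cycle_of_min_degree2 _ (@adjacent (edge_induced_subgraph D)) S X.
- by move=> Y Z; rewrite /adjacent multiplicityC.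
- by move=> Y; rewrite /adjacent multiplicityxx.
- by rewrite inE XE.
- move=> Y U; rewrite inE => sY.
  have [z [sz zU /lift [Y' [Z [Y'E ZE adj]]]]] := fan_step (val Y) (val (val U)) sY.
  exists Z; rewrite inE ZE; split=> //; first by apply: contraNneq zU => <-; rewrite ZE.
  by rewrite -(val_inj Y'E).
by move=> c [] /core_forest.
Qed.
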